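(* Let $A$ be a commutative ring, $\sigma$ a finite type almost jansian hereditary torsion theory in the category of $A$-modules, and $\sigma'$ the induced hereditary torsion theory in the category of $A[X]$-modules. If $A$ is totally $\sigma$-noetherian, then $A[X]$ is totally $\sigma'$-noetherian.
   Context: Rings are commutative with unit. A hereditary torsion theory $\sigma$ in the category of $A$-modules is given by its Gabriel filter $\mathcal{L}(\sigma)$: a non-empty filter of ideals of $A$ such that every ideal $\mathfrak{b}\subseteq A$ for which there exists $\mathfrak{a}\in\mathcal{L}(\sigma)$ with $(\mathfrak{b}:a)\in\mathcal{L}(\sigma)$ for every $a\in\mathfrak{a}$ belongs to $\mathcal{L}(\sigma)$. The theory $\sigma$ is of finite type if every ideal in $\mathcal{L}(\sigma)$ contains a finitely generated ideal belonging to $\mathcal{L}(\sigma)$. A finite type hereditary torsion theory $\sigma$ is almost jansian if $\bigcap_{n=1}^\infty\mathfrak{a}^n\in\mathcal{L}(\sigma)$ for every ideal $\mathfrak{a}\in\mathcal{L}(\sigma)$. A module $M$ is totally $\sigma$-torsion if there exists $\mathfrak{h}\in\mathcal{L}(\sigma)$ with $M\mathfrak{h}=0$. An ideal $\mathfrak{a}$ is totally $\sigma$-finitely generated if there is a finitely generated ideal $\mathfrak{a}'\subseteq\mathfrak{a}$ such that $\mathfrak{a}/\mathfrak{a}'$ is totally $\sigma$-torsion. A ring $A$ is totally $\sigma$-noetherian if every ideal of $A$ is totally $\sigma$-finitely generated. For a ring map $f:A\to B$, the hereditary torsion theory $f(\sigma)$ in the category of $B$-modules induced by $\sigma$ has Gabriel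 filter $\mathcal{L}(f(\sigma))=\{\mathfrak{b}\subseteq B\mid f^{-1}(\mathfrak{b})\in\mathcal{L}(\sigma)\}$; here $\sigma'$ is induced through the inclusion $A\to A[X]$. *)

(* Defs.v *)
(* Ideals are Prop-valued sets [set A], so that no decidability is assumed; the
   ideals of ring_quotient are boolean predicates and proper. *)
From HB Require Import structures.
From mathcomp Require Import all_boot all_order all_algebra.
From mathcomp Require Import boolp classical_sets cardinality.

Set Implicit Arguments.
Unset Strict Implicit.
Unset Printing Implicit Defensive.

Import GRing.Theory.
Local Open Scope classical_set_scope.
Local Open Scope ring_scope.

Definition is_ideal (A : comPzRingType) (I : set A) : Prop :=
  [/\ I 0, forall x y, I x -> I y -> I (x + y)
    & forall a x, I x -> I (a * x)].

Definition ideal_gen (A : comPzRingType) (S : set A) : set A :=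
  smallest (@is_ideal A) S.

Definition finitely_generated (A : comPzRingType) (I : set A) : Prop :=
  exists2 S : set A, finite_set S & I = ideal_gen S.

Definition ideal_mul (A : comPzRingType) (I J : set A) : set A :=
  ideal_gen [set x * y | x in I & y in J].

Definition ideal_exp (A : comPzRingType) (I : set A) (n : nat) : set A :=
  iter n (ideal_mul I) setT.

Definition colon (A : comPzRingType) (I : set A) (x : A) : set A :=
  [set y | I (x * y)].

(* A hereditary torsion theory, presented by its Gabriel filter. The filter
   may contain the zero ideal. *)
Record torsion_theory (A : comPzRingType) := TorsionTheory {
  gabriel :> set (set A);
  gabriel_ideal : forall I, gabriel I -> is_ideal I;
  gabriel_neq0 : gabriel !=set0;
  gabriel_up : forall I J, gabriel I -> is_ideal J -> I `<=` J -> gabriel J;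
  gabriel_setI : forall I J, gabriel I -> gabriel J -> gabriel (I `&` J);
  gabriel_colon : forall J, is_ideal J ->
    (exists2 I, gabriel I & forall x, I x -> gabriel (colon J x)) -> gabriel J
}.

Definition finite_type (A : comPzRingType) (sigma : torsion_theory A) : Prop :=
  forall I, gabriel sigma I ->
    exists J, [/\ gabriel sigma J, finitely_generated J & J `<=` I].

(* Only meaningful for theories of finite type; that condition is kept separate. *)
Definition almost_jansian (A : comPzRingType) (sigma : torsion_theory A) :
    Prop :=
  forall I, gabriel sigma I ->
    gabriel sigma (\bigcap_(n in [set n | (0 < n)%N]) ideal_exp I n).

(* For ideals J `<=` I: the module I / J is killed by some H in the filter. The
   class of x in I is killed by h exactly when x * h lies in J. *)
Definition totally_torsion_quotient (A : comPzRingType)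
    (sigma : torsion_theory A) (I J : set A) : Prop :=
  exists2 H, gabriel sigma H & forall x h, I x -> H h -> J (x * h).

Definition totally_finitely_generated (A : comPzRingType)
    (sigma : torsion_theory A) (I : set A) : Prop :=
  exists J, [/\ finitely_generated J, J `<=` I
              & totally_torsion_quotient sigma I J].

Definition totally_noetherian (A : comPzRingType) (sigma : torsion_theory A) :
    Prop :=
  forall I, is_ideal I -> totally_finitely_generated sigma I.

Section Induced.
Variables (A B : comPzRingType) (f : {rmorphism A -> B}).
Variable sigma : torsion_theory A.

Definition induced_filter : set (set B) :=
  [set J | is_ideal J /\ gabriel sigma (f @^-1` J)].

Lemma is_ideal_preimage (J : set B) : is_ideal J -> is_ideal (f @^-1` J).
Proof.
case=> J0 JD JM; split=> [|x y Jx Jy|a x Jx]; rewrite /preimage /=.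
- by rewrite rmorph0.
- by rewrite rmorphD; exact: JD.
- by rewrite rmorphM; exact: JM.
Qed.

Lemma induced_ideal J : induced_filter J -> is_ideal J.
Proof. by case. Qed.

Lemma induced_neq0 : induced_filter !=set0.
Proof.
exists setT; split=> //; have [I sI] := gabriel_neq0 sigma.
by apply: (gabriel_up sI).
Qed.

Lemma induced_up I J :
  induced_filter I -> is_ideal J -> I `<=` J -> induced_filter J.
Proof.
move=> [_ sI] idJ IJ; split=> //; apply: (gabriel_up sI).
  exact: is_ideal_preimage.
by move=> x; exact: IJ.
Qed.

Lemma induced_setI I J :
  induced_filter I -> induced_filter J -> induced_filter (I `&` J).
Proof.
move=> [[I0 ID IM] sI] [[J0 JD JM] sJ]; split; last exact: gabriel_setI.
split=> // [x y [Ix Jx] [Iy Jy]|a x [Ix Jx]]; split.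
- exact: ID.
- exact: JD.
- exact: IM.
- exact: JM.
Qed.

Lemma induced_colon J : is_ideal J ->
  (exists2 I, induced_filter I & forall x, I x -> induced_filter (colon J x)) ->
  induced_filter J.
Proof.
move=> idJ [I [_ sI] IJ]; split=> //.
apply: gabriel_colon; first exact: is_ideal_preimage.
exists (f @^-1` I) => // x /IJ [_].
suff -> : f @^-1` colon J (f x) = colon (f @^-1` J) x by [].
by apply/seteqP; split=> y; rewrite /colon /preimage /= rmorphM.
Qed.

Definition induced : torsion_theory B :=
  TorsionTheory induced_ideal induced_neq0 induced_up induced_setI
    induced_colon.

End Induced.

(* Main.v *)
(* Hilbert's basis argument. The leading coefficients of an ideal [I] of [A[X]]
   form an ideal which, up to multiplication by some [H] in the filter, is
   generated by the leading coefficients of finitely many [g] in [I] of degree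
   at most [d]. For [f] in [I], each multiplication by an element of [H] allows
   one division step by these [g], so that [H ^ k] brings [f] below degree [d]
   with [k] depending on the degree of [f]. The intersection of the powers of
   [H], which lies in the filter since [sigma] is almost jansian, does this for
   all [f] at once. Below degree [d] only finitely many coefficient ideals have
   to be treated. *)
Require Import Defs.
From HB Require Import structures.
From mathcomp Require Import all_boot all_order all_algebra.
From mathcomp Require Import boolp classical_sets cardinality.
From mathcomp Require Import ring.

Set Implicit Arguments.
Unset Strict Implicit.
Unset Printing Implicit Defensive.

Import GRing.Theory.
Local Open Scope classical_set_scope.
Local Open Scope ring_scope.

Section Ideals.
Variable A : comPzRingType.
Implicit Types (I J S T : set A).

Lemma ideal_genP S : is_ideal (ideal_gen S).
Proof.
split=> [J [[]]//|x y Sx Sy J JS|a x Sx J JS].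
- by have [[_ JD _] _] := JS; apply: JD; [exact: Sx|exact: Sy].
- by have [[_ _ JM] _] := JS; apply: JM; exact: Sx.
Qed.

Lemma sub_ideal_gen S : S `<=` ideal_gen S.
Proof. exact: sub_smallest. Qed.

Lemma ideal_gen_sub S J : is_ideal J -> S `<=` J -> ideal_gen S `<=` J.
Proof. by move=> idJ SJ x; apply. Qed.

Lemma ideal_gen_mono S T : S `<=` T -> ideal_gen S `<=` ideal_gen T.
Proof.
move=> ST; apply: ideal_gen_sub; first exact: ideal_genP.
exact: subset_trans ST (@sub_ideal_gen T).
Qed.

Lemma ideal_sub I x y : is_ideal I -> I x -> I y -> I (x - y).
Proof. by move=> [_ ID IM] Ix Iy; apply: ID; rewrite // -mulN1r; exact: IM. Qed.

Lemma colon_ideal I x : is_ideal I -> is_ideal (colon I x).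
Proof.
move=> [I0 ID IM]; split; rewrite /colon /=.
- by rewrite mulr0.
- by move=> y z ? ?; rewrite mulrDr; exact: ID.
- by move=> a y ?; rewrite mulrCA; exact: IM.
Qed.

End Ideals.

Section Transporter.
Variables (A B : comPzRingType) (f : {rmorphism A -> B}).
Implicit Types (J M N : set B).

(** This is the contraction to [A] of the ideal quotient (J : M). [M] is any set, since polynomials
    of bounded degree in an ideal need not form an ideal. *)
Definition transporter M J : set A := [set x | forall m, M m -> J (f x * m)].

Lemma transporter_ideal M J : is_ideal J -> is_ideal (transporter M J).
Proof.
move=> [J0 JD JM]; split=> [m _|x y Mx My m Mm|a x Mx m Mm].
- by rewrite rmorph0 mul0r.
- by rewrite rmorphD mulrDl; apply: JD; [exact: Mx|exact: My].
- by rewrite rmorphM -mulrA; apply: JM; exact: Mx.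
Qed.

(** Two reductions compose: [K] moves [M] into [N] modulo [J], and the transporter of [N] finishes.
    For [x] in [K], that transporter lies in the colon by [x] of the one of [M], so the Gabriel
    condition applies. *)
Lemma gabriel_transporter_trans (sigma : torsion_theory A) (K : set A) M N J :
    is_ideal J -> gabriel sigma K -> gabriel sigma (transporter N J) ->
    (forall x m, K x -> M m -> exists2 j, J j & N (f x * m - j)) ->
  gabriel sigma (transporter M J).
Proof.
move=> idJ sK sN KMN; apply: gabriel_colon; first exact: transporter_ideal.
exists K => // x Kx; apply: (gabriel_up sN).
  exact/colon_ideal/transporter_ideal.
move=> y Ny m Mm; have [j Jj /Ny Jyxm] := KMN x m Kx Mm.
have [_ JD JM] := idJ.
have -> : f (x * y) * m = f y * (f x * m - j) + f y * j.
  by rewrite rmorphM; ring.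
by apply: JD => //; exact: JM.
Qed.

End Transporter.

Section Coefficients.
Variable A : comNzRingType.
Implicit Types (I J : set {poly A}).

(** Degrees below [n] are allowed, contributing the coefficient 0; this makes the set closed under
    addition. *)
Definition coef_ideal I n : set A :=
  [set c | exists f, [/\ I f, (size f <= n.+1)%N & f`_n = c]].

Lemma coef_ideal_ideal I n : is_ideal I -> is_ideal (coef_ideal I n).
Proof.
move=> [I0 ID IM]; split.
- by exists 0; rewrite size_poly0 coef0.
- move=> _ _ [f [If sf <-]] [g [Ig sg <-]]; exists (f + g).
  split; [exact: ID| |by rewrite coefD].
  by rewrite (leq_trans (size_polyD _ _))// geq_max sf.
- move=> a _ [f [If sf <-]]; exists (a%:P * f).
  split; [exact: IM| |by rewrite coefCM].
  by rewrite mul_polyC (leq_trans (size_scale_leq _ _)).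
Qed.

(** Multiplication by ['X^(n - m)] shifts the leading coefficient. *)
Lemma coef_ideal_mono I m n : is_ideal I -> (m <= n)%N ->
  coef_ideal I m `<=` coef_ideal I n.
Proof.
move=> [_ _ IM] mn _ [f [If sf <-]]; exists ('X^(n - m) * f); split.
- exact: IM.
- rewrite (leq_trans (size_polyMleq _ _))// size_polyXn addSn /=.
  by rewrite (leq_trans (leq_add (leqnn _) sf))// addnS subnK.
- by rewrite coefXnM ltnNge leq_subr /= subKn.
Qed.

Lemma bigcup_coef_ideal_ideal I :
  is_ideal I -> is_ideal (\bigcup_n coef_ideal I n).
Proof.
move=> idI; split.
- by exists 0%N => //; have [] := coef_ideal_ideal 0 idI.
- move=> x y [m _ Ix] [n _ Iy]; exists (maxn m n) => //.
  have [_ ID _] := coef_ideal_ideal (maxn m n) idI.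
  by apply: ID; [apply: coef_ideal_mono Ix|apply: coef_ideal_mono Iy];
    rewrite ?leq_maxl ?leq_maxr.
- move=> a x [m _ Ix]; exists m => //.
  by have [_ _ IM] := coef_ideal_ideal m idI; exact: IM.
Qed.

Lemma finite_coef_ideal_bound I (S : set A) : is_ideal I -> finite_set S ->
  S `<=` \bigcup_n coef_ideal I n -> exists n, S `<=` coef_ideal I n.
Proof.
move=> idI /finite_seqP[s ->{S}]; elim: s => [|x s IH] sI.
  by exists 0%N => x; rewrite /= in_nil.
have [|n sn] := IH; first by move=> y ys; apply: sI; rewrite /= inE ys orbT.
have [|m _ xm] := sI x; first by rewrite /= mem_head.
exists (maxn m n) => y /=; rewrite inE => /orP[/eqP->|/sn yn].
  by apply: coef_ideal_mono xm; rewrite // leq_maxl.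
by apply: coef_ideal_mono yn; rewrite // leq_maxr.
Qed.

(** One polynomial is chosen for each element of [S]; the inclusion extends to [ideal_gen S] because
    its target is an ideal. *)
Lemma finite_coef_ideal_lift I (S : set A) n : finite_set S ->
    S `<=` coef_ideal I n ->
  exists T, [/\ finite_set T, T `<=` I
              & ideal_gen S `<=` coef_ideal (ideal_gen T) n].
Proof.
move=> finS SI.
have /choice[g gP] (c : A) : exists f, S c ->
    [/\ I f, (size f <= n.+1)%N & f`_n = c].
  have [/SI[f fP]|nSc] := pselect (S c); first by exists f.
  by exists 0 => /nSc.
exists (g @` S); split; first exact: finite_image.
  by move=> _ [c Sc <-]; have [] := gP c Sc.
apply: ideal_gen_sub => [|c Sc]; first exact/coef_ideal_ideal/ideal_genP.
exists (g c); have [Ig sg cg] := gP c Sc.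
by split=> //; apply: sub_ideal_gen; exists c.
Qed.

(** The division step: [j] is chosen to cancel the coefficient of degree [n] in [x%:P * f]. *)
Lemma coef_ideal_reduce J n (x : A) (f : {poly A}) : (size f <= n.+1)%N ->
    coef_ideal J n (f`_n * x) ->
  exists2 j, J j & (size (x%:P * f - j)%R <= n)%N.
Proof.
move=> sf [j [Jj sj jn]]; exists j => //.
apply/leq_sizeP => i; rewrite leq_eqVlt => /orP[/eqP<-|ni].
  by rewrite coefB coefCM jn mulrC subrr.
rewrite coefB coefCM (leq_sizeP _ _ sf)// (leq_sizeP _ _ sj)//.
by rewrite mulr0 subr0.
Qed.

End Coefficients.

Section Basis.
Variables (A : comNzRingType) (sigma : torsion_theory A).
Hypothesis A_noeth : totally_noetherian sigma.
Variable I : set {poly A}.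
Hypothesis idI : is_ideal I.

Let C := @polyC A : {rmorphism A -> {poly A}}.

Let bounded d : set {poly A} := [set f | I f /\ (size f <= d)%N].

(** Induction on [d]: up to [H], lifts of generators of the coefficient ideal in degree [d] remove
    the top coefficient, and the remainder has size at most [d]. *)
Lemma bounded_degree_basis d : exists T, [/\ finite_set T, T `<=` I
  & gabriel sigma (transporter C (bounded d) (ideal_gen T))].
Proof.
elim: d => [|d [T0 [finT0 T0I sT0]]].
  exists set0; split=> //; have [K sK] := gabriel_neq0 sigma.
  apply: (gabriel_up sK); first exact/transporter_ideal/ideal_genP.
  move=> x _ f [_]; rewrite leqn0 size_poly_eq0 => /eqP ->.
  by rewrite mulr0; have [] := ideal_genP (set0 : set {poly A}).
have [_ [[S finS ->] SL [H sH HL]]] := A_noeth (coef_ideal_ideal d idI).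
have [T1 [finT1 T1I ST1]] :=
  finite_coef_ideal_lift finS (subset_trans (@sub_ideal_gen _ S) SL).
have idT := ideal_genP (T0 `|` T1).
exists (T0 `|` T1); split.
- by rewrite finite_setU.
- by move=> f [/T0I|/T1I].
apply: (@gabriel_transporter_trans _ _ _ sigma H _ (bounded d)) => //.
  apply: (gabriel_up sT0); first exact: transporter_ideal.
  move=> x xT0 f /xT0; apply: ideal_gen_mono; exact: subsetUl.
move=> x f Hx [If sf].
have [|j Tj sj] := coef_ideal_reduce (J := ideal_gen T1) (x := x) sf.
  by apply: ST1; apply: HL => //; exists f.
exists j; first by apply: ideal_gen_mono Tj; exact: subsetUr.
split=> //; apply: ideal_sub => //; first by have [_ _ IM] := idI; exact: IM.
exact: (ideal_gen_sub idI T1I).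
Qed.

Lemma ideal_exp_reduce (H : set A) (J : set {poly A}) d : is_ideal J ->
    J `<=` I ->
    (forall n (f : {poly A}) x, (d <= n)%N -> I f -> (size f <= n.+1)%N ->
      H x -> coef_ideal J n (f`_n * x)) ->
  forall k (f : {poly A}) x, I f -> (size f <= d + k)%N -> ideal_exp H k x ->
    exists2 j, J j & (size (x%:P * f - j)%R <= d)%N.
Proof.
move=> idJ JI HJ; have [J0 JD JM] := idJ; have [_ _ IM] := idI.
elim=> [|k IH] f x If sf.
  move=> _; exists 0 => //; rewrite subr0 mul_polyC.
  by rewrite (leq_trans (size_scale_leq _ _))// -[d]addn0.
(* For fixed [f] these multipliers form an ideal, so only the products generating [ideal_exp H k.+1]
   need checking: the factor in [H] lowers the degree once, the factor in [ideal_exp H k] does the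
   rest by induction. *)
pose good := [set x | exists2 j, J j & (size (x%:P * f - j)%R <= d)%N].
suff : ideal_exp H k.+1 `<=` good by apply.
apply: ideal_gen_sub.
  split=> [|u v [i Ji si] [j Jj sj]|a u [j Jj sj]].
  - by exists 0; rewrite // mul0r subr0 size_poly0.
  - exists (i + j); first exact: JD.
    have -> : (u + v)%:P * f - (i + j) = (u%:P * f - i) + (v%:P * f - j).
      by rewrite polyCD; ring.
    by rewrite (leq_trans (size_polyD _ _))// geq_max si.
  - exists (a%:P * j); first exact: JM.
    have -> : (a * u)%:P * f - a%:P * j = a *: (u%:P * f - j).
      by rewrite polyCM -mul_polyC; ring.
    exact: leq_trans (size_scale_leq _ _) sj.
move=> _ [y Hy [z Hz <-]].
rewrite addnS in sf.
have [//|g Jg sg] := coef_ideal_reduce (J := J) (x := y) sf _.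
  by apply: HJ; rewrite // leq_addr.
have [|j Jj sj] := IH (y%:P * f - g) z _ sg Hz.
  by apply: ideal_sub => //; [exact: IM|exact: JI].
exists (z%:P * g + j); first by apply: JD => //; exact: JM.
suff -> : (y * z)%:P * f - (z%:P * g + j) = z%:P * (y%:P * f - g) - j by [].
by rewrite polyCM; ring.
Qed.

Lemma almost_jansian_basis : almost_jansian sigma ->
  exists T, [/\ finite_set T, T `<=` I
    & gabriel sigma (transporter C I (ideal_gen T))].
Proof.
move=> sigma_aj.
have [_ [[S finS ->] SL [H sH HL]]] := A_noeth (bigcup_coef_ideal_ideal idI).
have [d Sd] :=
  finite_coef_ideal_bound idI finS (subset_trans (@sub_ideal_gen _ S) SL).
have [T1 [finT1 T1I ST1]] := finite_coef_ideal_lift finS Sd.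
have [T0 [finT0 T0I sT0]] := bounded_degree_basis d.
have idT := ideal_genP (T0 `|` T1).
have TI : T0 `|` T1 `<=` I by move=> f [/T0I|/T1I].
exists (T0 `|` T1); split=> //; first by rewrite finite_setU.
(* The intersection of the powers of [H] serves as [K], independently of the degree of [f]. *)
apply: (gabriel_transporter_trans (N := bounded d) idT (sigma_aj H sH)).
  apply: (gabriel_up sT0); first exact: transporter_ideal.
  move=> x xT0 f /xT0; apply: ideal_gen_mono; exact: subsetUl.
move=> x f Kx If.
have genTI : ideal_gen (T0 `|` T1) `<=` I := ideal_gen_sub idI TI.
(* The successor keeps the exponent positive even for [f = 0], as the intersection starts at
   exponent 1. *)
have [||||j Tj sj] := @ideal_exp_reduce H _ d idT genTI _ (size f).+1 f x.
(* All leading coefficients, whatever their degree, are covered by [T1] in degree [d]; a shift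
   carries this to degree [n]. *)
- move=> n g y dn Ig sg Hy; apply: (coef_ideal_mono idT dn).
  have [h [T1h sh <-]] : coef_ideal (ideal_gen T1) d (g`_n * y).
    by apply: ST1; apply: HL => //; exists n => //; exists g.
  by exists h; split=> //; apply: ideal_gen_mono T1h; exact: subsetUr.
- by [].
- by rewrite addnS ltnW// ltnS leq_addl.
- exact: Kx.
exists j => //; split=> //; apply: ideal_sub => //; last exact: genTI.
by have [_ _ IM] := idI; exact: IM.
Qed.

End Basis.

Theorem theorem7 (A : comNzRingType) (sigma : torsion_theory A)
    (sigma_ft : finite_type sigma) (sigma_aj : almost_jansian sigma)
    (A_noeth : totally_noetherian sigma) :
  totally_noetherian (induced (@polyC A : {rmorphism A -> {poly A}}) sigma).
Proof.
move=> I idI.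
have [T [finT TI sT]] := almost_jansian_basis A_noeth idI sigma_aj.
exists (ideal_gen T); split; [by exists T|exact: ideal_gen_sub|].
(* The annihilating ideal must live in [{poly A}]: it is the quotient of [ideal_gen T] by [I] there,
   whose contraction to [A] is the transporter in [sT]. *)
exists (transporter (idfun : {rmorphism {poly A} -> {poly A}}) I (ideal_gen T)).
  by split=> //; exact/transporter_ideal/ideal_genP.
by move=> f p If pT; rewrite mulrC; exact: pT.
Qed.
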